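(* Let $E$ be an infinite extremally disconnected compact Hausdorff space and let $e$ be the essential completion operator on $\mathbf{W}^*$. Then $\mathcal{V}(C(E),e)$ has a minimum if and only if $E$ is (homeomorphic to) $\beta D$ for some discrete space $D$, and in that case the minimum is $F(\alpha D)$.
   Context: $\mathbf{W}^*$ is the category of Archimedean vector lattices with distinguished strong unit and unit-preserving vector lattice homomorphisms. For compact Hausdorff $X$, $C(X)\in\mathbf{W}^*$ is the vector lattice of continuous real-valued functions on $X$ with unit the constant function $1$; $F(X)=\{f\in C(X): f(X)\text{ is finite}\}$. An injective morphism $f:A\to B$ is essential if for every $0<b\in B$ there are $0<a\in A$ and $n\in\mathbb{N}$ with $f(a)\le nb$; then $(B,f)$ is an essential extension of $A$. For essential extensions of $A$, $(B_1,f_1)\le(B_2,f_2)$ iff there is a morphism $f:B_1\to B_2$ with $f_2=f\circ f_1$; extensions $\le$ each other are identified, giving $\operatorname{ext}A$. Each $A\in\mathbf{W}^*$ has a maximum essential extension $(eA,e_A)\in\operatorname{ext}A$, the essential completion of $A$; the objects with $eA=A$ are exactly the $C(X)$ with $X$ compact extremally disconnected. $\mathcal{V}(C(E),e)=\{A\in\mathbf{W}^*:eA=C(E)\}$, where $A$ is identified with the pair $(A,e_A)$; i.e. the elements are pairs $(A,f)$ with $f:A\to C(E)$ an essential embedding such that $(C(E),f)=(eA,e_A)$ in $\operatorname{ext}A$. Order: $(A_1,f_1)\le(A_2,f_2)$ iff there is an essential embedding $f:A_1\to A_2$ with $f_1=f_2\circ f$; pairs that are $\le$ each other are identified. $\alpha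 D$ and $\beta D$ are the one-point and the Čech–Stone compactifications of the infinite discrete space $D$; $F(\alpha D)$ is embedded in $C(\beta D)$ by composition with the covering map $\beta D\to\alpha D$ that sends $\beta D\setminus D$ to the point at infinity and is the identity on $D$. *)

(* Defs.v *)
From HB Require Import structures.
From mathcomp Require Import all_boot all_order all_algebra.
From mathcomp Require Import all_classical all_reals all_analysis.

Set Implicit Arguments.
Unset Strict Implicit.
Unset Printing Implicit Defensive.

Import Order.TTheory GRing.Theory Num.Theory numFieldNormedType.Exports.

Local Open Scope classical_set_scope.
Local Open Scope ring_scope.

HB.mixin Record isCompactHausdorff X & Topological X := {
  compact_setT : compact [set: X];
  compact_hausdorff : hausdorff_space X
}.

#[short(type="compactHausdorffType")]
HB.structure Definition CompactHausdorff :=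
  {X of Topological X & isCompactHausdorff X}.

(* The lattice operations are characterized by their order properties: the
   hierarchy has no join of GRing.Lmodule and Order.Lattice below RealDomain,
   so Order.Lattice cannot be inherited here. *)
HB.mixin Record isVectorLattice (R : realType) V
    & GRing.Lmodule R V & Order.POrder ring_display V := {
  vjoin : V -> V -> V;
  vmeet : V -> V -> V;
  vjoin_le : forall x y z : V, (vjoin x y <= z) = (x <= z) && (y <= z);
  vmeet_ge : forall x y z : V, (z <= vmeet x y) = (z <= x) && (z <= y);
  vle_add2l : forall z x y : V, x <= y -> z + x <= z + y;
  vscale_ge0 : forall (a : R) (x : V), 0 <= a -> 0 <= x -> 0 <= a *: x
}.

#[short(type="vectorLatticeType")]
HB.structure Definition VectorLattice (R : realType) :=
  {V of GRing.Lmodule R V & Order.POrder ring_display V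
      & isVectorLattice R V}.

HB.mixin Record isWStar (R : realType) V & VectorLattice R V := {
  archimedean_vl : forall x y : V, (forall n, x *+ n <= y) -> x <= 0;
  strong_unit : V;
  strong_unit_ge0 : 0 <= strong_unit;
  strong_unitP : forall x : V, exists n, vjoin x (- x) <= strong_unit *+ n
}.

#[short(type="wstarType")]
HB.structure Definition WStar (R : realType) :=
  {V of VectorLattice R V & isWStar R V}.

Definition C (R : realType) (X : topologicalType) := continuousType X R.

Section ContinuousFunctions.
Variables (R : realType) (X : topologicalType).

Definition cts_pred : {pred X -> R} := mem [set f | continuous f].

Let val_cts (f : C R X) : X -> R := f.
Let Sub_cts (f : X -> R) (cf : f \in cts_pred) : C R X := mkcts (set_mem cf).

Fact cts_subP (f : C R X) : Continuous.sort f \in cts_pred.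
Proof. by apply/mem_set; exact: cts_fun. Qed.

Fact cts_sub_rect (K : C R X -> Type) :
  (forall f cf, K (@Sub_cts f cf)) -> forall u, K u.
Proof.
move=> H u; rewrite (_ : u = Sub_cts (cts_subP u)) //.
by apply/continuousEP.
Qed.

HB.instance Definition _ := isSub.Build _ cts_pred (C R X) cts_sub_rect
  (fun f cf => erefl f : val_cts (Sub_cts cf) = f).
HB.instance Definition _ := [Choice of C R X by <:].

Fact cts_submod_closed : submod_closed cts_pred.
Proof.
split=> [|a f g /set_mem/= cf /set_mem/= cg]; apply/mem_set.
  by move=> x; exact: cvg_cst.
by move=> x; apply: cvgD; [apply: cvgZr; exact: cf | exact: cg].
Qed.

HB.instance Definition _ :=
  GRing.isSubmodClosed.Build R (X -> R) cts_pred cts_submod_closed.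

HB.instance Definition _ := [SubChoice_isSubLmodule of C R X by <:].
HB.instance Definition _ :=
  [SubChoice_isSubPOrder of C R X by <: with ring_display].

Implicit Types f g h : C R X.

Lemma C_leP f g : reflect (forall x, f x <= g x) (f <= g).
Proof. exact: lefP. Qed.

Lemma C_addE f g x : (f + g) x = f x + g x. Proof. by []. Qed.

Lemma C_oppE f x : (- f) x = - f x. Proof. by []. Qed.

Lemma C_scaleE a f x : (a *: f) x = a * f x. Proof. by []. Qed.

Lemma C_0E x : (0 : C R X) x = 0. Proof. by []. Qed.

Lemma C_mulrnE f n x : (f *+ n) x = f x *+ n.
Proof. by elim: n => [|n IHn]; rewrite ?mulr0n// !mulrS C_addE IHn. Qed.

Fact C_max_continuous f g : continuous (fun x => Num.max (f x : R) (g x : R)).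
Proof.
move=> x.
by apply: (@continuous_max _ _ f g); exact: cts_fun.
Qed.

Fact C_min_continuous f g : continuous (fun x => Num.min (f x : R) (g x : R)).
Proof.
move=> x.
by apply: (@continuous_min _ _ f g); exact: cts_fun.
Qed.

Definition C_max f g : C R X := mkcts (@C_max_continuous f g).
Definition C_min f g : C R X := mkcts (@C_min_continuous f g).

Fact C_max_le f g h : (C_max f g <= h) = (f <= h) && (g <= h).
Proof.
apply/C_leP/andP => [H|[/C_leP H1 /C_leP H2] x]; last first.
  by rewrite ge_max H1 H2.
by split; apply/C_leP => x; move: (H x); rewrite ge_max => /andP[].
Qed.

Fact C_min_ge f g h : (h <= C_min f g) = (h <= f) && (h <= g).
Proof.
apply/C_leP/andP => [H|[/C_leP H1 /C_leP H2] x]; last first.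
  by rewrite le_min H1 H2.
by split; apply/C_leP => x; move: (H x); rewrite le_min => /andP[].
Qed.

Fact C_le_add2l h f g : f <= g -> h + f <= h + g.
Proof. by move=> /C_leP fg; apply/C_leP => x; rewrite !C_addE (lerD2l (h x)). Qed.

Fact C_scale_ge0 (a : R) f : 0 <= a -> 0 <= f -> 0 <= a *: f.
Proof.
move=> a0 /C_leP f0; apply/C_leP => x.
by rewrite C_scaleE mulr_ge0// f0.
Qed.

HB.instance Definition _ := isVectorLattice.Build R (C R X)
  C_max_le C_min_ge C_le_add2l C_scale_ge0.

Fact C_archimedean f g : (forall n, f *+ n <= g) -> f <= 0.
Proof.
move=> H; apply/C_leP => x; rewrite leNgt; apply/negP => fx0.
have /C_leP/(_ x) := H (Num.bound (`|g x| / f x)).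
rewrite C_mulrnE leNgt => /negP; apply.
apply: (le_lt_trans (ler_norm _)).
by rewrite -mulr_natl -ltr_pdivrMr//; apply: archi_boundP; rewrite divr_ge0 ?normr_ge0 ?(ltW fx0).
Qed.

Definition C_one : C R X := cst 1.

Lemma C_oneE x : C_one x = 1. Proof. by []. Qed.

Fact C_one_ge0 : 0 <= C_one.
Proof. by apply/C_leP => x. Qed.

Definition finite_range : {pred C R X} := mem [set f : C R X | finite_set (range f)].

Record F : Type := MkF { F_val : C R X; F_valP : F_val \in finite_range }.

HB.instance Definition _ := [isSub for F_val].
HB.instance Definition _ := [Choice of F by <:].

Lemma finite_range2 (op : R -> R -> R) (f g h : X -> R) :
  (forall x, h x = op (f x) (g x)) ->
  finite_set (range f) -> finite_set (range g) -> finite_set (range h).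
Proof.
move=> E ff fg.
apply: (@sub_finite_set _ _ [set op y z | y in range f & z in range g]).
  by move=> _ [x _ <-]; exists (f x); [exists x|exists (g x); [exists x|]].
exact: finite_image2.
Qed.

Fact finite_range_submod : submod_closed finite_range.
Proof.
split=> [|a f g /set_mem/= ff /set_mem/= fg]; apply/mem_set => /=.
  by apply: (@sub_finite_set _ _ [set 0]) => // _ [x _ <-].
exact: (@finite_range2 (fun y z => a * y + z) f g (a *: f + g : C R X)).
Qed.

HB.instance Definition _ :=
  GRing.isSubmodClosed.Build R (C R X) finite_range finite_range_submod.
HB.instance Definition _ := [SubChoice_isSubLmodule of F by <:].
HB.instance Definition _ :=
  [SubChoice_isSubPOrder of F by <: with ring_display].

Fact F_max_subproof (f g : F) : C_max (F_val f) (F_val g) \in finite_range.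
Proof.
apply/mem_set => /=.
apply: (@finite_range2 Num.max (F_val f) (F_val g)) => //;
  exact: set_mem (F_valP _).
Qed.

Fact F_min_subproof (f g : F) : C_min (F_val f) (F_val g) \in finite_range.
Proof.
apply/mem_set => /=.
apply: (@finite_range2 Num.min (F_val f) (F_val g)) => //;
  exact: set_mem (F_valP _).
Qed.

Definition F_max (f g : F) : F := MkF (F_max_subproof f g).
Definition F_min (f g : F) : F := MkF (F_min_subproof f g).

Fact F_max_le (f g h : F) : (F_max f g <= h) = (f <= h) && (g <= h).
Proof. exact: C_max_le. Qed.

Fact F_min_ge (f g h : F) : (h <= F_min f g) = (h <= f) && (h <= g).
Proof. exact: C_min_ge. Qed.

Fact F_le_add2l (h f g : F) : f <= g -> h + f <= h + g.
Proof. exact: C_le_add2l. Qed.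

Fact F_scale_ge0 (a : R) (f : F) : 0 <= a -> 0 <= f -> 0 <= a *: f.
Proof. exact: C_scale_ge0. Qed.

HB.instance Definition _ := isVectorLattice.Build R F
  F_max_le F_min_ge F_le_add2l F_scale_ge0.

End ContinuousFunctions.

Section StrongUnits.
Variables (R : realType) (X : compactHausdorffType).

Fact C_strong_unitP (f : C R X) :
  exists n, vjoin f (- f) <= C_one R X *+ n.
Proof.
have : compact (range f).
  apply: continuous_compact; last exact: compact_setT.
  by apply: continuous_subspaceT; exact: cts_fun.
move=> /compact_bounded[M [_ /(_ (M + 1))]].
rewrite ltrDl ltr01 => /(_ isT) fM.
exists (Num.bound (`|M + 1|)); apply/C_leP => x.
rewrite C_mulrnE C_oneE /= (@ge_max _ R) C_oppE.
have fx : `|f x| <= (Num.bound (`|M + 1|))%:R.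
  apply: le_trans (fM (f x) _) _; first by exists x.
  by rewrite (le_trans (ler_norm _))// ltW// archi_boundP.
by rewrite (le_trans (ler_norm _) fx)/= (le_trans _ fx)// -normrN ler_norm.
Qed.

HB.instance Definition _ := isWStar.Build R (C R X)
  (@C_archimedean R X) (@C_one_ge0 R X) C_strong_unitP.

Fact F_one_subproof : C_one R X \in @finite_range R X.
Proof. by apply/mem_set => /=; apply: (@sub_finite_set _ _ [set 1]) => // _ [x _ <-]. Qed.

Definition F_one : F R X := MkF F_one_subproof.

Lemma F_val_mulrn (f : F R X) n : F_val (f *+ n) = F_val f *+ n.
Proof. by elim: n => [|n IHn]; rewrite ?mulr0n// !mulrS -IHn. Qed.

Fact F_archimedean (f g : F R X) : (forall n, f *+ n <= g) -> f <= 0.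
Proof.
move=> H; apply: (@C_archimedean R X (F_val f) (F_val g)) => n.
by rewrite -F_val_mulrn; exact: H.
Qed.

Fact F_one_ge0 : 0 <= F_one.
Proof. exact: C_one_ge0. Qed.

Fact F_strong_unitP (f : F R X) : exists n, vjoin f (- f) <= F_one *+ n.
Proof.
have [n H] := C_strong_unitP (F_val f); exists n.
suff : C_max (F_val f) (- F_val f) <= F_val (F_one *+ n) by [].
by rewrite F_val_mulrn.
Qed.

HB.instance Definition _ := isWStar.Build R (F R X)
  F_archimedean F_one_ge0 F_strong_unitP.

End StrongUnits.

Section OnePoint.
Variable D : discreteTopologicalType.

Fact discrete_locally_compact : locally_compact [set: D].
Proof.
move=> x _; rewrite withinET; exists [set x]; first exact: discrete_set1.
by split; [exact: compact_set1 | exact: discrete_closed].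
Qed.

HB.instance Definition _ :=
  isCompactHausdorff.Build (one_point_compactification D)
    (@one_point_compactification_compact D)
    (one_point_compactification_hausdorff
      discrete_locally_compact discrete_hausdorff).

End OnePoint.

Definition alpha (D : discreteTopologicalType) : compactHausdorffType :=
  one_point_compactification D.

Section StoneCech.
Variables (R : realType) (X : topologicalType).

Definition unit_functions : set (X -> R) :=
  [set f : X -> R | continuous f /\ forall x, 0 <= f x <= 1].

Definition beta_eval (x : X) : {ptws unit_functions -> R} :=
  fun u => set_val u x.

(* The closure of the image of X in the cube [0, 1]^C(X, [0, 1]); see
   beta_universal for its universal property. *)
Definition beta : Type := closure (range beta_eval).

HB.instance Definition _ := Topological.copy beta (closure (range beta_eval)).

Definition beta_unit (x : X) : beta :=
  exist _ (beta_eval x)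
    (mem_set (subset_closure (imageP beta_eval (I : setT x)))).

Definition beta_coord (u : unit_functions) (z : beta) : R := set_val z u.

Lemma beta_coord_unit u x : beta_coord u (beta_unit x) = set_val u x.
Proof. by []. Qed.

Lemma beta_coord_continuous u : continuous (beta_coord u).
Proof.
move=> z.
apply: (@continuous_comp _ _ _ (set_val : beta -> {ptws unit_functions -> R})
  (fun h => h u)).
  exact: initial_continuous.
exact: (@proj_continuous _ (fun _ => R) u).
Qed.

Fact beta_compact : compact [set: beta].
Proof.
pose cube := [set h : {ptws unit_functions -> R} |
  forall u, `[0, 1]%classic (h u)].
have ccube : compact cube.
  exact: (@tychonoff _ (fun _ : unit_functions => R)
    (fun _ => `[0, 1]%classic) (fun _ => @segment_compact R 0 1)).
have clcube : closed cube.
  rewrite (_ : cube = \bigcap_(u in [set: unit_functions])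
      ((fun h : {ptws unit_functions -> R} => h u) @^-1` `[0, 1]%classic)).
    apply: closed_bigI => u _; apply: preimage_closed.
      by move=> h _; exact: (@proj_continuous _ (fun _ => R) u).
    exact: interval_closed.
  by apply/seteqP; split => h H u; [move=> _; exact: (H u) | exact: (H u I)].
have cA : compact (closure (range beta_eval)).
  apply: subclosed_compact; [exact: closed_closure|exact: ccube|].
  rewrite [X in _ `<=` X](closure_id _).1//.
  apply: closureS => _ [x _ <-] u /=.
  by rewrite in_itv/=; have [_ ] := set_valP u; exact.
move=> G PG GT.
pose v : beta -> {ptws unit_functions -> R} := set_val.
have GA : fmap v G (closure (range beta_eval)).
  by apply: (@filterS _ G _ setT) => // z _; exact: (set_valP z).
have [] := cA (fmap v G) (fmap_proper_filter _ PG) GA.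
move=> p [Ap Gp]; exists (exist _ p (mem_set Ap)); split => //.
move=> A B GA' [_ [[W oW <-] Wp] WB].
have vA : fmap v G (v @` A).
  by apply: (@filterS _ G _ A) => // z Az; exists z.
have [_ [[z Az <-] Wz]] := Gp (v @` A) W vA (open_nbhs_nbhs (conj oW Wp)).
by exists z; split => //; exact: WB.
Qed.

Fact beta_hausdorff : hausdorff_space beta.
Proof.
move=> z w zw; apply: val_inj; apply/funext => u.
apply: (@Rhausdorff R) => A B Az Bw.
have [v [Av Bv]] := zw _ _ (beta_coord_continuous Az) (beta_coord_continuous Bw).
by exists (beta_coord u v).
Qed.

HB.instance Definition _ :=
  isCompactHausdorff.Build beta beta_compact beta_hausdorff.

Lemma beta_unit_continuous : continuous beta_unit.
Proof.
apply: continuous_comp_initial => x.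
apply/cvg_sup => u B [_ [[W oW <-] Wx] WB].
have [cu _] := set_valP u.
have H := cu x W (open_nbhs_nbhs (conj oW Wx)).
apply: (@filterS _ (nbhs x) _ _ _ _ H) => y Wy.
exact: WB.
Qed.

Lemma beta_unit_dense : dense (range beta_unit).
Proof.
move=> O [z Oz] [W oW WO].
have Wz : W (set_val z) by move: Oz; rewrite -WO.
have [_ [[x _ <-] Wx]] := set_valP z W (open_nbhs_nbhs (conj oW Wz)).
by exists (beta_unit x); split; [rewrite -WO | exists x].
Qed.

End StoneCech.

Arguments unit_functions : clear implicits.
Arguments beta_unit R {X} x.

Theorem beta_universal (R : realType) (X : topologicalType)
    (K : compactHausdorffType) (f : X -> K) : continuous f ->
  exists2 g : beta R X -> K, continuous g & g \o @beta_unit R X = f.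
Proof.
move=> cf.
have sep (k : K) (B : set K) : closed B -> ~ B k ->
    exists g : K -> R, [/\ continuous g, forall y, 0 <= g y <= 1, g k = 0 &
      forall y, B y -> g y = 1].
  move=> cB nBk.
  have nK : normal_space K.
    by apply: compact_normal; [exact: compact_hausdorff|exact: compact_setT].
  have aK : accessible_space K.
    by apply: hausdorff_accessible; exact: compact_hausdorff.
  have /(@uniform_separatorP K R)[g [cg g01 g0 g1]] :=
    @normal_completely_regular R K nK aK k B cB nBk.
  exists g; split=> //.
  - by move=> y; have := g01 (g y) (imageP _ I); rewrite /= in_itv.
  - by apply: g0; exists k.
  - by move=> y By; apply: g1; exists y.
have pull (g : K -> R) : continuous g -> (forall y, 0 <= g y <= 1) ->
    unit_functions R X (g \o f).
  move=> cg g01; split=> [x|x]; last exact: g01.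
  by apply: continuous_comp; [exact: cf | exact: cg].
have ext (z : beta R X) : {k : K | forall (g : K -> R) (u : unit_functions R X),
    continuous g -> set_val u = g \o f -> g k = beta_coord u z}.
  apply: cid.
  pose G := filter_from (nbhs z) (fun W => @beta_unit R X @^-1` W).
  have PG : ProperFilter G.
    apply: filter_from_proper; last first.
      move=> W; rewrite nbhsE; case=> O [oO Oz] OW.
      have [y [Oy [x _ xE]]] := @beta_unit_dense R X O (ex_intro _ z Oz) oO.
      by exists x; apply: OW; rewrite xE.
    apply: filter_from_filter; first by exists setT; exact: filterT.
    move=> A B Az Bz; exists (A `&` B) => //; exact: filterI.
  have [k [_ kG]] := @compact_setT K (f @ G) _ filterT.
  exists k; move=> g u cg uE; apply: (@Rhausdorff R) => A B Ak Bz.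
  have [||y [[x Bx <-] Ay]] := kG (f @` ((beta_coord u \o @beta_unit R X) @^-1` B))
    (g @^-1` A).
  - exists (beta_coord u @^-1` B); first exact: (@beta_coord_continuous R X u).
    by move=> x /= Bx; exists x.
  - exact: cg.
  exists (g (f x)); split => //; move: Bx => /=.
  by rewrite beta_coord_unit uE.
exists (fun z => sval (ext z)).
  move=> z U; rewrite nbhsE; case=> O [oO Ok] OU.
  have [|g [cg g01 gk gO]] := sep (sval (ext z)) (~` O) (open_closedC oO).
    by apply.
  pose u : unit_functions R X := exist _ (g \o f) (mem_set (pull g cg g01)).
  have uE : set_val u = g \o f by [].
  have /= := @beta_coord_continuous R X u z [set t | t < 1].
  move=> H; have {}H : nbhs z (beta_coord u @^-1` [set t | t < 1]).
    apply: H; apply: lt_nbhsl => //.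
    by rewrite -(svalP (ext z) g u cg uE) gk ltr01.
  apply: filterS H => w /= wlt; apply: OU; apply: contrapT => nO.
  by move: wlt; rewrite -(svalP (ext w) g u cg uE) gO// ltxx.
apply/funext => x /=; set k := sval _.
apply: contrapT => kx.
have [||g [cg g01 gk gx]] := sep k [set f x].
- apply: accessible_closed_set1; exact: hausdorff_accessible compact_hausdorff.
- by [].
pose u : unit_functions R X := exist _ (g \o f) (mem_set (pull g cg g01)).
have := svalP (ext (beta_unit R x)) g u cg erefl.
rewrite beta_coord_unit -/k gk /= => /esym; rewrite /u set_valE /= gx//.
by move/eqP; rewrite oner_eq0.
Qed.

Section Covering.
Variables (R : realType) (D : discreteTopologicalType).

(* None is the point at infinity of alpha D. *)
Definition covering (z : beta R D) : alpha D :=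
  if pselect (exists d, beta_unit R d = z) is left ex
  then Some (sval (cid ex)) else None.

Fact indicator_unit_function (d : D) :
  unit_functions R D (fun y => (y == d)%:R).
Proof.
split=> [y U Uy|y]; last first.
  by rewrite ler0n lern1 leq_b1.
apply: filterS (discrete_set1 y) => _ ->; exact: nbhs_singleton Uy.
Qed.

Let indicator_unit (d : D) : unit_functions R D :=
  exist (fun f => f \in unit_functions R D) _
    (mem_set (indicator_unit_function d)).

Lemma beta_unit_inj : injective (@beta_unit R D).
Proof.
move=> d d' dd'.
pose u := indicator_unit d.
have := congr1 (beta_coord u) dd'.
rewrite !beta_coord_unit set_valE /= eqxx.
by case: eqP => [->//|_ /eqP]; rewrite oner_eq0.
Qed.

Lemma beta_unit_isolated (d : D) : open [set beta_unit R d].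
Proof.
pose u := indicator_unit d.
pose O : set (beta R D) := beta_coord u @^-1` [set t | 0 < t].
have oO : open O.
  apply: open_comp; last exact: open_gt.
  by move=> z _; exact: beta_coord_continuous.
have cd : closed [set beta_unit R d].
  apply: accessible_closed_set1; apply: hausdorff_accessible.
  exact: compact_hausdorff.
suff -> : [set beta_unit R d] = O by [].
apply/seteqP; split=> z; first by move=> ->; rewrite /O/= beta_coord_unit set_valE/= eqxx ltr01.
move=> Oz; apply: contrapT => zd.
have [|w [[Ow wd] [y _ yw]]] := @beta_unit_dense R D (O `&` ~` [set beta_unit R d])
  (ex_intro _ z (conj Oz zd)).
  by apply: openI => //; exact: closed_openC.
move: Ow wd; rewrite -yw /O/= beta_coord_unit set_valE/=.
by case: eqP => [->//|_]; rewrite ltxx.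
Qed.

Lemma covering_unit d : covering (beta_unit R d) = Some d.
Proof.
rewrite /covering; case: pselect => [ex|[]]; last by exists d.
by congr Some; apply: beta_unit_inj; exact: (svalP (cid ex)).
Qed.

Lemma covering_notin z : ~ range (beta_unit R) z -> covering z = None.
Proof.
move=> nz; rewrite /covering; case: pselect => // -[d dz].
by case: nz; exists d.
Qed.

Lemma covering_continuous : continuous covering.
Proof.
move=> z; have [[d _ <-]|nz] := pselect (range (beta_unit R) z).
  move=> U Ud; apply: (@filterS _ (nbhs (beta_unit R d)) _ [set beta_unit R d]).
    by move=> _ ->; exact: nbhs_singleton Ud.
  by apply: open_nbhs_nbhs; split => //; exact: beta_unit_isolated.
move=> U; rewrite (covering_notin nz) => -[K [cK clK] KU].
have cl : closed (beta_unit R @` K).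
  apply: compact_closed; first exact: compact_hausdorff.
  apply: continuous_compact => //; apply: continuous_subspaceT.
  exact: beta_unit_continuous.
apply: (@filterS _ (nbhs z) _ (~` (beta_unit R @` K))).
  move=> w nw; apply: KU.
  have [[d _ dw]|/covering_notin ->] := pselect (range (beta_unit R) w); last by right.
  left; exists d; last by rewrite -dw covering_unit.
  by move=> Kd; apply: nw; exists d.
apply: open_nbhs_nbhs; split; first exact: closed_openC.
by move=> [d _ dz]; apply: nz; exists d.
Qed.

Definition covering_map : continuousType (beta R D) (alpha D) :=
  mkcts covering_continuous.

End Covering.

Definition extremally_disconnected (X : topologicalType) :=
  forall U : set X, open U -> open (closure U).

Definition homeomorphism (X Y : topologicalType) (h : X -> Y) :=
  exists g : Y -> X,
    [/\ continuous h, continuous g, cancel h g & cancel g h].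

Definition homeomorphic (X Y : topologicalType) :=
  exists h : X -> Y, homeomorphism h.

Section Category.
Variable R : realType.
Implicit Types A B : wstarType R.

Definition wstar_morphism A B (f : A -> B) :=
  [/\ linear f,
      {morph f : x y / vjoin x y},
      {morph f : x y / vmeet x y} &
      f strong_unit = strong_unit].

Definition essential_embedding A B (f : A -> B) :=
  [/\ wstar_morphism f,
      injective f &
      forall b, 0 < b -> exists a n, 0 < a /\ f a <= b *+ n].

Record essential_extension A := EssentialExtension {
  ext_obj : wstarType R;
  ext_map : A -> ext_obj;
  ext_mapP : essential_embedding ext_map
}.

Arguments ext_map {A} _ _.

Definition ext_le A (x y : essential_extension A) :=
  exists2 f : ext_obj x -> ext_obj y,
    wstar_morphism f & ext_map y = f \o ext_map x.

(* Preorder quotients are not formed: a maximum of ext A, or a minimum of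
   calV below, is an element comparable with all others, that is, a representative
   of the maximum, or minimum, equivalence class. *)
Definition is_essential_completion A (x : essential_extension A) :=
  forall y : essential_extension A, ext_le y x.

Record object_over B := ObjectOver {
  over_obj : wstarType R;
  over_map : over_obj -> B
}.

Arguments over_map {B} _ _.

Definition over_le B (p q : object_over B) :=
  exists2 f : over_obj p -> over_obj q,
    essential_embedding f & over_map p = over_map q \o f.

Definition calV (E : compactHausdorffType) (p : object_over (C R E)) : Prop :=
  exists p_ess : essential_embedding (over_map p),
    is_essential_completion (EssentialExtension p_ess).

Definition is_minimum B (S : object_over B -> Prop) (m : object_over B) :=
  S m /\ forall p, S p -> over_le m p.

Definition C_precomp (X Y : topologicalType) (h : continuousType X Y)
  (f : C R Y) : C R X := f \o h.

Definition F_alpha_embedding (D : discreteTopologicalType)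
    (u : F R (alpha D)) : C R (beta R D) :=
  C_precomp (covering_map R D) (F_val u).

Definition F_alpha_over (D : discreteTopologicalType)
    (E : compactHausdorffType) (h : continuousType E (beta R D)) :
    object_over (C R E) :=
  ObjectOver (C_precomp h \o @F_alpha_embedding D).

End Category.

Arguments ext_map {R A} _ _.
Arguments over_map {R B} _ _.

(* Main.v *)
Require Import Defs.
From HB Require Import structures.
From mathcomp Require Import all_boot all_order all_algebra lra.
From mathcomp Require Import all_classical all_reals all_analysis.

Set Implicit Arguments.
Unset Strict Implicit.
Unset Printing Implicit Defensive.

Import Order.TTheory GRing.Theory Num.Theory numFieldNormedType.Exports.

Local Open Scope classical_set_scope.
Local Open Scope ring_scope.

(** Real scalars turn essentiality of an embedding into order density
    (essential_dense): below every positive element of the target lies the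
    image of a positive element of the source.  Let g : A -> B and f : A -> V
    be essential with V Dedekind complete.  Then phi b, the supremum of the
    f a with g a <= b, is a morphism B -> V extending f.  The crux is that
    phi b is also the infimum of the f a with b <= g a: a gap between the two
    would contain some f a0 with a0 > 0, and lowering an upper bound of b
    repeatedly by a0 would contradict the Archimedean property.  Since C(E) is
    Dedekind complete for extremally disconnected E, every essential embedding
    into C(E) is an essential completion, so V(C(E), e) consists of all the
    essential embeddings into C(E) (calVP).

    If E = beta D, the indicator of a point of D is an atom of C(E), so a
    multiple of it lies in the image of every order dense A.  Together with
    the unit, these indicators span F(alpha D), which is thus contained in
    every A.  It is order dense itself because D is dense in beta D, and hence
    it is the minimum (F_alpha_minimum).

    Conversely let M be a minimum.  For non-isolated x and y, the functions
    with f x = f y form an order dense subobject of C(E), so those of M satisfy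
    f x = f y: they are constant on the set of non-isolated points.  An open
    set without isolated points would carry a bump function vanishing at one of
    its points, and no positive function of M lies below that bump function.
    So the isolated points are dense (minimum_isolated_dense).  Then E is the
    Cech-Stone compactification of the discrete space D of isolated points: the
    continuous extension beta D -> E of the inclusion is onto by density, and
    it is injective because disjoint sets of isolated points have disjoint
    closures in E (isolated_dense_homeomorphic). *)

(** * Order in vector lattices *)

Section VectorLattices.
Variables (R : realType) (V : vectorLatticeType R).
Implicit Types x y z : V.

Lemma vle_addl x y z : (z + x <= z + y) = (x <= y).
Proof.
apply/idP/idP => [/(vle_add2l (- z))|]; first by rewrite !addKr.
exact: vle_add2l.
Qed.

Lemma vle_addr x y z : (x + z <= y + z) = (x <= y).
Proof. by rewrite ![_ + z]addrC vle_addl. Qed.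

Lemma vsub_ge0 x y : (0 <= y - x) = (x <= y).
Proof. by rewrite -(vle_addr 0 _ x) add0r subrK. Qed.

Lemma vle_subr x y z : (x <= y - z) = (x + z <= y).
Proof. by rewrite -(vle_addr x (y - z) z) subrK. Qed.

Lemma vle_opp x y : (- x <= - y) = (y <= x).
Proof. by rewrite -(vsub_ge0 (- x)) opprK addrC vsub_ge0. Qed.

Lemma vle_opl x y : (- x <= y) = (- y <= x).
Proof. by rewrite -[LHS]vle_opp opprK. Qed.

Lemma vle_opr x y : (x <= - y) = (y <= - x).
Proof. by rewrite -[LHS]vle_opp opprK. Qed.

Lemma vsub_gt0 x y : x <= y -> x != y -> 0 < y - x.
Proof. by move=> xy nxy; rewrite lt_neqAle vsub_ge0 xy eq_sym subr_eq0 eq_sym nxy. Qed.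

Lemma vle_scale (a : R) x y : 0 < a -> (a *: x <= a *: y) = (x <= y).
Proof.
move=> a0; rewrite -(vsub_ge0 (a *: x)) -scalerBr -(vsub_ge0 x).
apply/idP/idP => [|xy]; last by apply: vscale_ge0 => //; exact: ltW.
move=> /(@vscale_ge0 _ _ a^-1); rewrite scalerA mulVf ?gt_eqF// scale1r.
by apply; rewrite invr_ge0 ltW.
Qed.

Lemma vscale_gt0 (a : R) x : 0 < a -> 0 < x -> 0 < a *: x.
Proof.
move=> a0 x0; rewrite lt_neqAle vscale_ge0 ?ltW// andbT eq_sym.
by rewrite scaler_eq0 negb_or !gt_eqF.
Qed.

Lemma vmeet_lel x y : vmeet x y <= x.
Proof. by have := lexx (vmeet x y); rewrite vmeet_ge => /andP[]. Qed.

Lemma vmeet_ler x y : vmeet x y <= y.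
Proof. by have := lexx (vmeet x y); rewrite vmeet_ge => /andP[]. Qed.

Lemma vmeet_idP x y : reflect (vmeet x y = x) (x <= y).
Proof.
apply: (iffP idP) => [xy|<-]; last exact: vmeet_ler.
by apply: le_anti; rewrite vmeet_lel vmeet_ge lexx xy.
Qed.

Lemma vjoin_gel x y : x <= vjoin x y.
Proof. by have := lexx (vjoin x y); rewrite vjoin_le => /andP[]. Qed.

Lemma vjoin_ger x y : y <= vjoin x y.
Proof. by have := lexx (vjoin x y); rewrite vjoin_le => /andP[]. Qed.

Lemma vjoin_opp x y : vjoin x y = - vmeet (- x) (- y).
Proof.
apply: le_anti; rewrite vjoin_le !(vle_opr _ (vmeet _ _)) vmeet_lel vmeet_ler.
by rewrite vle_opl vmeet_ge !vle_opp vjoin_gel vjoin_ger.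
Qed.

End VectorLattices.

(** * Order-dense embeddings *)

Section Morphisms.
Variables (R : realType) (A B : wstarType R) (f : A -> B).

Section Linear.
Hypothesis fL : linear f.

(** A morphism is a bare function with a proof of linearity, whence these rules
    that take the proof as an argument. *)
Lemma linearD_of x y : f (x + y) = f x + f y.
Proof. by have := fL 1 x y; rewrite /= !scale1r. Qed.

Lemma linear0_of : f 0 = 0.
Proof. by apply: (addrI (f 0)); rewrite -linearD_of !addr0. Qed.

Lemma linearZ_of a x : f (a *: x) = a *: f x.
Proof. by have := fL a x 0; rewrite /= linear0_of !addr0. Qed.

Lemma linearN_of x : f (- x) = - f x.
Proof. by rewrite -scaleN1r linearZ_of scaleN1r. Qed.

Lemma linearMn_of x n : f (x *+ n) = f x *+ n.
Proof. by rewrite -scaler_nat linearZ_of scaler_nat. Qed.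

End Linear.

Section Embedding.
Hypothesis fM : wstar_morphism f.

Lemma morphism_le x y : x <= y -> f x <= f y.
Proof.
have [_ _ fI _] := fM.
by move=> /vmeet_idP xy; apply/vmeet_idP; rewrite -fI xy.
Qed.

Hypothesis fi : injective f.

Lemma embedding_le x y : (f x <= f y) = (x <= y).
Proof.
have [_ _ fI _] := fM.
apply/idP/idP; last exact: morphism_le.
by move=> /vmeet_idP xy; apply/vmeet_idP/fi; rewrite fI.
Qed.

Lemma embedding_gt0 x : (0 < f x) = (0 < x).
Proof.
have [/linear0_of f0 _ _ _] := fM.
by rewrite !lt_neqAle -f0 embedding_le f0 -{1}f0 (inj_eq fi).
Qed.

End Embedding.

End Morphisms.

Section OrderDense.
Variables (R : realType) (A B : wstarType R) (f : A -> B).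
Hypothesis fE : essential_embedding f.

Let fM : wstar_morphism f. Proof. by case: fE. Qed.
Let fi : injective f. Proof. by case: fE. Qed.
Let fL : linear f. Proof. by case: fM. Qed.

(** The integer factor in the definition of essentiality is absorbed by
    dividing the witness by it. *)
Lemma essential_dense b : 0 < b -> exists2 a, 0 < a & f a <= b.
Proof.
case: fE => _ _ fe /fe[a [[|n] [a0 fab]]].
  move: fab; rewrite mulr0n => fa0; move: a0.
  by rewrite -(embedding_gt0 fM fi) => /lt_le_trans/(_ fa0); rewrite ltxx.
have n0 : 0 < (n.+1%:R : R)^-1 by rewrite invr_gt0.
exists (n.+1%:R^-1 *: a); first exact: vscale_gt0.
rewrite (linearZ_of fL) -[leRHS]scale1r -[in leRHS](@mulVf R n.+1%:R) ?pnatr_eq0//.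
by rewrite -scalerA vle_scale// scaler_nat.
Qed.

Lemma embedding_unit_bound (b : B) :
  exists n, - f (strong_unit *+ n) <= b /\ b <= f (strong_unit *+ n).
Proof.
have [n] := strong_unitP b; rewrite vjoin_le => /andP[bn nbn].
case: fM => _ _ _ f1; exists n; rewrite (linearMn_of fL) f1.
by rewrite vle_opl.
Qed.

(** Iterating the descent from one upper bound of [b] keeps all multiples of
    [a0] below a fixed element, which the Archimedean property forbids. *)
Lemma no_infinite_descent (b : B) a0 : 0 < a0 ->
  ~ (forall a, b <= f a -> b <= f (a - a0)).
Proof.
move=> a00 desc; have [n [_ bn]] := embedding_unit_bound b.
have [m [mb _]] := embedding_unit_bound b.
have down k : b <= f (strong_unit *+ n - a0 *+ k).
  elim: k => [|k IHk]; first by rewrite mulr0n subr0.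
  by rewrite mulrSr opprD addrA; exact: desc.
suff : a0 <= 0 by move=> /(lt_le_trans a00); rewrite ltxx.
apply: (@archimedean_vl _ _ _ (strong_unit *+ n + strong_unit *+ m)) => k.
have := le_trans mb (down k); rewrite -(linearN_of fL) (embedding_le fM fi).
by rewrite vle_subr -[X in _ -> _ <= _ + X]opprK vle_subr addrC.
Qed.

(** Order density makes every [b] the supremum of the image elements below it:
    otherwise some positive [f a0] fits between [b] and a smaller bound, adding
    [a0] preserves lying below [b], and this descends forever for [- b]. *)
Lemma le_of_lower_bounds b c : (forall a, f a <= b -> f a <= c) -> b <= c.
Proof.
move=> bc; apply/vmeet_idP/eqP/contraT => nbc.
have [a0 a00] := essential_dense (vsub_gt0 (vmeet_lel b c) nbc).
rewrite vle_subr => a0b.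
case: (@no_infinite_descent (- b) a0 a00) => a.
rewrite vle_opl -(linearN_of fL) => ab.
rewrite vle_opl -(linearN_of fL) opprB (linearD_of fL).
by apply: le_trans a0b; rewrite vle_addl vmeet_ge ab bc.
Qed.

Lemma le_of_upper_bounds b c : (forall a, b <= f a -> c <= f a) -> c <= b.
Proof.
move=> bc; rewrite -vle_opp; apply: le_of_lower_bounds => a.
by rewrite !(vle_opr (f a)) -(linearN_of fL); exact: bc.
Qed.

End OrderDense.

(** * Extension to an essential extension *)

Definition dedekind_complete (R : realType) (V : vectorLatticeType R) :=
  forall S : set V, S !=set0 -> (exists u, forall x, S x -> x <= u) ->
  exists s, (forall x, S x -> x <= s) /\
    (forall u, (forall x, S x -> x <= u) -> s <= u).

Section Extension.
Variables (R : realType) (A B V : wstarType R) (g : A -> B) (f : A -> V).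
Hypotheses (gE : essential_embedding g) (fE : essential_embedding f).
Hypothesis Vc : dedekind_complete V.

Let gM : wstar_morphism g. Proof. by case: gE. Qed.
Let gi : injective g. Proof. by case: gE. Qed.
Let gL : linear g. Proof. by case: gM. Qed.
Let fM : wstar_morphism f. Proof. by case: fE. Qed.
Let fi : injective f. Proof. by case: fE. Qed.
Let fL : linear f. Proof. by case: fM. Qed.

Fact lower_sup_exists (b : B) : exists s : V,
  (forall a, g a <= b -> f a <= s) /\
  (forall u, (forall a, g a <= b -> f a <= u) -> s <= u).
Proof.
have [n [nb bn]] := embedding_unit_bound gE b.
have [||s [sub slub]] := Vc (S := [set f a | a in [set a | g a <= b]]).
- by exists (f (- (strong_unit *+ n))), (- (strong_unit *+ n)) => //=; rewrite (linearN_of gL).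
- exists (f (strong_unit *+ n)) => _ [a /= ab <-].
  by rewrite (embedding_le fM fi) -(embedding_le gM gi); exact: le_trans ab bn.
exists s; split=> [a ab|u ubu]; first by apply: sub; exists a.
by apply: slub => _ [a /= ab <-]; exact: ubu.
Qed.

Definition extension (b : B) : V := sval (cid (lower_sup_exists b)).
Local Notation phi := extension.

Lemma extension_ge a b : g a <= b -> f a <= phi b.
Proof. by have [+ _] := svalP (cid (lower_sup_exists b)); exact. Qed.

Lemma extension_lub b u : (forall a, g a <= b -> f a <= u) -> phi b <= u.
Proof. by have [_] := svalP (cid (lower_sup_exists b)); exact. Qed.

Lemma extension_le a b : b <= g a -> phi b <= f a.
Proof.
move=> ba; apply: extension_lub => a' a'b.
by rewrite (embedding_le fM fi) -(embedding_le gM gi); exact: le_trans a'b ba.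
Qed.

Lemma extension_homo : {homo phi : b c / b <= c}.
Proof.
by move=> b c bc; apply: extension_lub => a ab; apply: extension_ge; exact: le_trans ab bc.
Qed.

Lemma extensionE a : phi (g a) = f a.
Proof. by apply: le_anti; rewrite extension_le ?extension_ge. Qed.

(** The key point, from which additivity follows: [phi b], defined from below,
    is also approximated from above.  A gap would dominate some [f a0] with
    [0 < a0], so every [a] with [b <= g a] could be lowered by [a0]. *)
Lemma extension_glb b u : (forall a, b <= g a -> u <= f a) -> u <= phi b.
Proof.
move=> ub; apply: le_trans (vjoin_gel u (phi b)) _.
set j := vjoin u (phi b).
have [->//|nj] := eqVneq (phi b) j.
have [a0 a00] := essential_dense fE (vsub_gt0 (vjoin_ger u (phi b)) nj).
rewrite vle_subr => a0j.
have [] := no_infinite_descent gE (b := b) a00; move=> a ba.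
apply: (le_of_lower_bounds gE) => a' a'b.
rewrite (embedding_le gM gi) vle_subr -(embedding_le fM fi) addrC (linearD_of fL).
apply: (@le_trans _ _ j).
  by apply: le_trans a0j; rewrite vle_addl extension_ge.
by rewrite vjoin_le ub// extension_le.
Qed.

(** Elements of [B] are determined by the bounds they have in [A], and [phi]
    keeps those bounds. *)
Lemma extension_le_reflect b c : phi b <= phi c -> b <= c.
Proof.
move=> bc; apply: (le_of_lower_bounds gE) => a ab.
apply: (le_of_upper_bounds gE) => a' ca'.
rewrite (embedding_le gM gi) -(embedding_le fM fi).
by rewrite (le_trans (extension_ge ab))// (le_trans bc)// extension_le.
Qed.

Lemma extensionN b : phi (- b) = - phi b.
Proof.
apply: le_anti; apply/andP; split.
  rewrite vle_opr; apply: extension_lub => a ab.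
  by rewrite vle_opr -(linearN_of fL) extension_le// (linearN_of gL) vle_opp.
apply: extension_glb => a; rewrite vle_opl -(linearN_of gL) => /extension_ge.
by rewrite (linearN_of fL) vle_opl.
Qed.

Lemma extensionD b c : phi (b + c) = phi b + phi c.
Proof.
(* Superadditivity at [- b] and [- c] is subadditivity at [b] and [c]. *)
have superadd b' c' : phi b' + phi c' <= phi (b' + c').
  rewrite -vle_subr; apply: extension_lub => a ab.
  rewrite vle_subr addrC -vle_subr; apply: extension_lub => a' a'c.
  rewrite vle_subr addrC -(linearD_of fL); apply: extension_ge.
  by rewrite (linearD_of gL) (@le_trans _ _ (b' + g a'))// ?vle_addr ?vle_addl.
apply: le_anti; rewrite superadd andbT.
by rewrite -vle_opp opprD -!extensionN opprD superadd.
Qed.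

Lemma extension_pos_scale (k : R) b : 0 < k -> phi (k *: b) = k *: phi b.
Proof.
have le_scale (l : R) c : 0 < l -> l *: phi c <= phi (l *: c).
  move=> l0; have li0 : 0 < l^-1 by rewrite invr_gt0.
  rewrite -(vle_scale _ _ li0) scalerA mulVf ?gt_eqF// scale1r.
  apply: extension_lub => a ac.
  rewrite -(vle_scale _ _ l0) scalerA mulfV ?gt_eqF// scale1r -(linearZ_of fL).
  by apply: extension_ge; rewrite (linearZ_of gL) vle_scale.
move=> k0; have ki0 : 0 < k^-1 by rewrite invr_gt0.
apply: le_anti; rewrite le_scale// andbT.
rewrite -(vle_scale _ _ ki0) (le_trans (le_scale _ _ ki0))//.
by rewrite !scalerA mulVf ?gt_eqF// !scale1r.
Qed.

Lemma extension_linear : linear phi.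
Proof.
have phi0 : phi 0 = 0 by rewrite -(linear0_of gL) extensionE (linear0_of fL).
move=> k b c; rewrite extensionD; congr (_ + _).
have [k0|k0|->] := ltgtP k 0; last by rewrite !scale0r.
  have nk : 0 < - k by rewrite oppr_gt0.
  by rewrite -[k]opprK !(scaleNr (- k)) extensionN extension_pos_scale.
exact: extension_pos_scale.
Qed.

(** If [phi (vmeet b c)] were smaller than the meet of the images, some [f a0]
    could be added to it, and reflecting the order would place [g a0 + vmeet b c] below
    both [b] and [c]. *)
Lemma extension_meet : {morph phi : b c / vmeet b c}.
Proof.
move=> b c /=; set m := vmeet b c; set k := vmeet _ _.
have mk : phi m <= k by rewrite vmeet_ge !extension_homo ?vmeet_lel ?vmeet_ler.
apply/eqP/contraT => nmk.
have [a0 a00] := essential_dense fE (vsub_gt0 mk nmk).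
rewrite vle_subr -extensionE -extensionD => a0k.
have : g a0 + m <= 0 + m.
  by rewrite add0r vmeet_ge !extension_le_reflect// (le_trans a0k)// ?vmeet_lel ?vmeet_ler.
rewrite vle_addr; move: a00; rewrite -(embedding_gt0 gM gi) => /lt_le_trans H /H.
by rewrite ltxx.
Qed.

Lemma extension_morphism : wstar_morphism phi.
Proof.
split; [exact: extension_linear| |exact: extension_meet|].
  by move=> b c; rewrite !vjoin_opp extensionN extension_meet !extensionN.
by case: gM => _ _ _ <-; rewrite extensionE; case: fM.
Qed.

End Extension.

Theorem essential_completion_of_complete (R : realType) (A V : wstarType R)
    (f : A -> V) (fE : essential_embedding f) :
  dedekind_complete V -> is_essential_completion (EssentialExtension fE).
Proof.
move=> Vc [B g gE]; exists (extension gE fE Vc); first exact: extension_morphism.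
by apply/funext => a /=; rewrite extensionE.
Qed.

(** * Dedekind completeness of C(X) *)

Section DedekindComplete.
Variables (R : realType) (X : topologicalType).

Lemma C_lt_open (f : C R X) (r : R) : open [set x | r < f x].
Proof.
apply: (@open_comp _ _ f [set t | r < t]); last exact: open_gt.
by move=> x _; exact: cts_fun.
Qed.

Lemma C_le_closed (f : C R X) (r : R) : closed [set x | r <= f x].
Proof.
apply: (@preimage_closed _ _ f [set t | r <= t]); last exact: closed_ge.
by move=> x _; exact: cts_fun.
Qed.

Lemma C_gt0_point (b : C R X) : 0 < b -> exists x, 0 < b x.
Proof.
rewrite lt_neqAle => /andP[/eqP b_neq0 /C_leP b_ge0]; apply: contrapT => nb.
apply: b_neq0; apply/continuousEP => x; apply: le_anti; rewrite b_ge0 leNgt.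
by apply/negP => bx; apply: nb; exists x.
Qed.

(** The pointwise supremum is only lower semicontinuous.  Its regularization
    [h x], the supremum of the [r] such that [x] is in the closure of the set
    where the pointwise supremum exceeds [r], is continuous because these
    closures are open. *)
Lemma C_dedekind_complete :
  extremally_disconnected X -> dedekind_complete (C R X).
Proof.
move=> Xed S [f0 Sf0] [k Sk].
pose U (r : R) := [set x | exists2 f : C R X, S f & r < f x].
have oU r : open (U r).
  rewrite (_ : U r = \bigcup_(f in S) [set x | r < (f : C R X) x]).
    by apply: bigcup_open => f _; exact: C_lt_open.
  by apply/seteqP; split=> x [f Sf rf]; exists f.
have clU_ub r (u : C R X) :
    (forall f, S f -> f <= u) -> closure (U r) `<=` [set x | r <= u x].
  move=> Su; rewrite [X in _ `<=` X](closure_id _).1; last exact: C_le_closed.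
  by apply: closureS => x [f /Su/C_leP fu rf]; exact: le_trans (ltW rf) (fu x).
pose Q x := [set r | closure (U r) x].
have Qsup x : has_sup (Q x).
  split; last by exists (k x) => r; exact: clU_ub.
  by exists (f0 x - 1); apply: subset_closure; exists f0; rewrite // ltrBlDr ltrDl.
have Qdown x r r' : Q x r -> r' <= r -> Q x r'.
  move=> + r'r; apply: closureS => y [f Sf rf].
  by exists f => //; exact: le_lt_trans r'r rf.
pose h x := sup (Q x).
have ch : continuous h.
  move=> x; apply/cvgrPdist_lt => e e0.
  have [r Qr hr] := sup_adherent e0 (Qsup x).
  have nQ : ~ Q x (h x + e / 2).
    move=> /(ub_le_sup (Qsup x).2); rewrite -/(h x) gerDl leNgt.
    by rewrite divr_gt0.
  have near_r : nbhs x (closure (U r)).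
    by apply: open_nbhs_nbhs; split => //; exact: Xed.
  have near_e : nbhs x (~` closure (U (h x + e / 2))).
    apply: open_nbhs_nbhs; split => //.
    by apply: closed_openC; exact: closed_closure.
  apply: filterS2 near_r near_e => y yr ye.
  have rh : r <= h y by apply: (ub_le_sup (Qsup y).2).
  have he : h y <= h x + e / 2.
    apply: ge_sup; first exact: (Qsup y).1.
    move=> t Qt; rewrite leNgt; apply/negP => /ltW /(Qdown _ _ _ Qt).
    exact: ye.
  rewrite ltr_norml; move: (hr) rh he; rewrite -/(h x) => *.
  lra.
pose H : C R X := mkcts ch.
exists H; split=> [f Sf|u Su].
  apply/C_leP => x /=; apply/ler_addgt0Pr => e e0; rewrite -lerBlDr.
  apply: (ub_le_sup (Qsup x).2); apply: subset_closure.
  by exists f => //; rewrite ltrBlDr ltrDl.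
apply/C_leP => x /=; apply: ge_sup; first exact: (Qsup x).1.
by move=> r; exact: clU_ub.
Qed.

End DedekindComplete.

Lemma calVP (R : realType) (E : compactHausdorffType) (p : object_over (C R E)) :
  extremally_disconnected E -> calV p <-> essential_embedding (over_map p).
Proof.
move=> Eed; split=> [[]//|pE]; exists pE.
by apply: essential_completion_of_complete; exact: C_dedekind_complete.
Qed.

(** * Functions of finite range on the one-point compactification *)

Lemma compact_discrete_finite (D : discreteTopologicalType) (K : set D) :
  compact K -> finite_set K.
Proof.
have [->//|/set0P[x0 _]] := eqVneq K set0.
(* A point of [K] turns [D] into a pointed space, where compactness yields
   finite subcovers. *)
pose pD : ptopologicalType :=
  HB.pack (DiscreteTopology.sort D) (isPointed.Build (DiscreteTopology.sort D) x0).
change (@compact pD K -> finite_set K); rewrite compact_cover => cK.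
have [|x Kx|S SK KS] := cK D K (fun d : D => [set d]).
- by move=> d _; exact: discrete_open.
- by exists x.
apply: (sub_finite_set KS); apply: bigcup_finite => //; exact: finite_fset.
Qed.

Lemma factor_embedding (R : realType) (A B V : wstarType R)
    (f : A -> V) (e : B -> V) (l : B -> A) :
  essential_embedding f -> essential_embedding e -> (forall u, f (l u) = e u) ->
  essential_embedding l.
Proof.
move=> [fM fi _] [eM ei ee] fl.
have [fL fJ fI f1] := fM; have [eL eJ eI e1] := eM.
split.
- split.
  + by move=> k u v; apply: fi; rewrite fL !fl eL.
  + by move=> u v; apply: fi; rewrite fJ !fl eJ.
  + by move=> u v; apply: fi; rewrite fI !fl eI.
  + by apply: fi; rewrite f1 fl.
- by move=> u v uv; apply: ei; rewrite -!fl uv.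
- move=> b; rewrite -(embedding_gt0 fM fi) => /ee[u [n [u0 un]]].
  exists u, n; split => //; rewrite -(embedding_le fM fi) fl.
  by rewrite (linearMn_of fL).
Qed.

Lemma compact_accessible (K : compactHausdorffType) : accessible_space K.
Proof. by apply: hausdorff_accessible; exact: compact_hausdorff. Qed.

Lemma closed_point (K : compactHausdorffType) (x : K) : closed [set x].
Proof. exact/accessible_closed_set1/compact_accessible. Qed.

Section FiniteRangeFunctions.
Variables (R : realType) (D : discreteTopologicalType) (d : D).

Lemma alpha_some_isolated : open [set (Some d : alpha D)].
Proof.
rewrite (_ : [set _] = Some @` [set d]); last by rewrite image_set1.
by apply: one_point_compactification_open_some; exact: discrete_open.
Qed.

Fact alpha_indicator_continuous :
  continuous (fun o : alpha D => (o == Some d)%:R : R).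
Proof.
move=> o U /nbhs_singleton /= Uo.
have cd : closed [set (Some d : alpha D)] by exact: closed_point.
have [od|od] := eqVneq o (Some d : alpha D).
  apply: (@filterS _ (nbhs o) _ [set (Some d : alpha D)]).
    by move=> _ -> /=; move: Uo; rewrite od eqxx.
  by apply: open_nbhs_nbhs; split => //; exact: alpha_some_isolated.
apply: (@filterS _ (nbhs o) _ (~` [set (Some d : alpha D)])).
  by move=> o' /= /eqP/negbTE ->; move: Uo; rewrite (negbTE od).
by apply: open_nbhs_nbhs; split; [exact: closed_openC|exact/eqP].
Qed.

Fact alpha_indicator_finite :
  (mkcts alpha_indicator_continuous : C R (alpha D)) \in @finite_range R (alpha D).
Proof.
apply/mem_set; apply: (@sub_finite_set _ _ [set 0; 1]); last exact: finite_set2.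
move=> _ [x _ <-]; set b := (x == Some d :> alpha D).
by change ([set 0; 1 : R] (b%:R)); case: b; [right|left].
Qed.

Definition alpha_indicator : F R (alpha D) := MkF alpha_indicator_finite.

End FiniteRangeFunctions.

Section FAlpha.
Variables (R : realType) (D : discreteTopologicalType).

(** The range being finite, the value at infinity is taken on a neighborhood of
    infinity, whose complement is compact, hence finite, in [D]. *)
Lemma F_finite_support (u : F R (alpha D)) :
  finite_set [set d | F_val u (Some d) != F_val u None].
Proof.
have fu : finite_set (range (F_val u)) := set_mem (F_valP u).
pose T := range (F_val u) `\ F_val u None.
have cT : closed T.
  apply: accessible_finite_set_closed.1.
    by apply: hausdorff_accessible; exact: Rhausdorff.
  by apply: sub_finite_set fu => r [].
have : nbhs (None : alpha D) (F_val u @^-1` (~` T)).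
  apply: (@cts_fun _ _ (F_val u) None); apply: open_nbhs_nbhs; split; first exact: closed_openC.
  by move=> [_]; apply.
move=> [K [/compact_discrete_finite fK _] KT].
apply: sub_finite_set fK => d /eqP du; apply: contrapT => nKd.
by apply: (KT (Some d)); [left; exists d|split => //; exists (Some d)].
Qed.

(** In an infinite [D], two finite supports do not exhaust [D], so the value at
    infinity is visible on [D]. *)
Lemma F_alpha_eq (u v : F R (alpha D)) : infinite_set [set: D] ->
  (forall d, F_val u (Some d) = F_val v (Some d)) -> u = v.
Proof.
move=> Dinf uv; apply: val_inj; apply/continuousEP => -[d|]; first exact: uv.
apply: contrapT => nuv; apply: Dinf.
apply: (@sub_finite_set _ _ ([set d | F_val u (Some d) != F_val u None] `|`
   [set d | F_val v (Some d) != F_val v None])); last first.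
  by rewrite finite_setU; split; exact: F_finite_support.
move=> d _; have [du|du] := eqVneq (F_val u (Some d)) (F_val u None); [right|left] => //=.
by apply/eqP => dv; apply: nuv; rewrite /= -du -dv; exact: uv.
Qed.

End FAlpha.

(** * Minimality of the functions of finite range *)

Section FAlphaEmbedding.
Variables (R : realType) (E : compactHausdorffType) (D : discreteTopologicalType).
Variable h : continuousType E (beta R D).
Hypothesis hH : homeomorphism h.
Hypothesis E_infinite : infinite_set [set: E].

Local Notation emb := (over_map (F_alpha_over h)).

(** A finite [D] would be closed and dense in its compactification, hence all of
    it.  The infinity of [D] is what makes the covering map onto. *)
Lemma index_infinite : infinite_set [set: D].
Proof.
move=> fD; apply: E_infinite; have [g [_ _ hK gK]] := hH.
have fbeta : finite_set (range (@beta_unit R D)) by exact: finite_image.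
have cbeta : closed (range (@beta_unit R D)).
  exact: (accessible_finite_set_closed.1 (@compact_accessible _)).
apply: (@sub_finite_set _ _ (g @` range (@beta_unit R D))); last exact: finite_image.
move=> e _; exists (h e); last exact: hK.
apply: contrapT => nhe.
have [|z []] := @beta_unit_dense R D (~` range (@beta_unit R D)) (ex_intro _ (h e) nhe).
  exact: closed_openC.
by [].
Qed.

Lemma F_alphaE (u : F R (alpha D)) e : emb u e = F_val u (covering (h e)).
Proof. by []. Qed.

Lemma F_alpha_at (u : F R (alpha D)) e d : h e = beta_unit R d ->
  emb u e = F_val u (Some d).
Proof. by move=> he; rewrite F_alphaE he covering_unit. Qed.

Lemma F_alpha_outside (u : F R (alpha D)) e : ~ range (@beta_unit R D) (h e) ->
  emb u e = F_val u None.
Proof. by move=> he; rewrite F_alphaE covering_notin. Qed.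

Lemma alpha_indicator_eq1 d e :
  h e = beta_unit R d -> emb (alpha_indicator R d) e = 1 :> R.
Proof.
move=> he; rewrite (F_alpha_at _ he).
by change ((Some d == Some d :> alpha D)%:R = 1 :> R); rewrite eqxx.
Qed.

Lemma alpha_indicator_eq0 d e :
  h e <> beta_unit R d -> emb (alpha_indicator R d) e = 0 :> R.
Proof.
move=> he; rewrite F_alphaE.
change ((covering (h e) == Some d :> alpha D)%:R = 0 :> R).
have [[d' _ d'e]|ne] := pselect (range (@beta_unit R D) (h e)); last first.
  by rewrite covering_notin.
rewrite -d'e covering_unit; have [[dd']|//] := eqVneq (Some d' : alpha D) (Some d).
by case: he; rewrite -d'e dd'.
Qed.

Lemma alpha_indicator_gt0 (d : D) : 0 < alpha_indicator R d.
Proof.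
rewrite lt_neqAle; apply/andP; split.
  apply/eqP => /(congr1 (fun u => F_val u (Some d : alpha D))).
  change (0 = (Some d == Some d :> alpha D)%:R :> R -> False); rewrite eqxx => /esym/eqP.
  by rewrite oner_eq0.
apply/C_leP => o; change (0 <= (o == Some d :> alpha D)%:R :> R).
exact: ler0n.
Qed.

Lemma F_alpha_dense_point (b : C R E) : 0 < b ->
  exists e d, h e = beta_unit R d /\ 0 < b e.
Proof.
move=> b0; have [g [ch cg hK gK]] := hH.
have [e be] := C_gt0_point b0.
have [| |z [/= gz [d _ dz]]] := @beta_unit_dense R D (g @^-1` [set e | 0 < b e]).
- by exists (h e); rewrite /= hK.
- by apply: open_comp; [move=> z _; exact: cg|exact: C_lt_open].
by exists (g z), d; rewrite gK.
Qed.

Lemma F_alpha_morphism : wstar_morphism emb.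
Proof. by split=> [k u v|u v|u v|]; apply/continuousEP. Qed.

(** A positive function is positive at some [d], where it dominates a multiple
    of the indicator of [d]. *)
Lemma F_alpha_essential : essential_embedding emb.
Proof.
split; first exact: F_alpha_morphism.
  move=> u v uv; apply: (F_alpha_eq index_infinite) => d.
  have [g [_ _ _ gK]] := hH.
  by rewrite -!(F_alpha_at _ (gK (beta_unit R d))) uv.
move=> b b0; have [e [d [ed be]]] := F_alpha_dense_point b0.
exists (b e *: alpha_indicator R d), 1%N; split.
  exact/vscale_gt0/alpha_indicator_gt0.
rewrite (linearZ_of (let: And4 l _ _ _ := F_alpha_morphism in l)) mulr1n.
apply/C_leP => e'; rewrite C_scaleE.
have [he|/alpha_indicator_eq0 ->] := pselect (h e' = beta_unit R d).
  rewrite (alpha_indicator_eq1 he) mulr1 (_ : e' = e)//.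
  by have [g [_ _ hK _]] := hH; apply: (can_inj hK); rewrite he.
by rewrite mulr0; move/ltW/C_leP: b0; exact.
Qed.

Variables (A : wstarType R) (f : A -> C R E).
Hypothesis fE : essential_embedding f.

(** The indicator of an isolated point is an atom of the vector lattice of
    continuous functions: what lies between 0 and it is a multiple of it. *)
Lemma alpha_indicator_in_image d : exists a, f a = emb (alpha_indicator R d).
Proof.
have [fM fi _] := fE; have [fL _ _ _] := fM.
have [g [_ _ hK gK]] := hH.
pose e := g (beta_unit R d).
have he : h e = beta_unit R d by exact: gK.
have [a a0 /C_leP fa] : exists2 a, 0 < a & f a <= emb (alpha_indicator R d).
  apply: (essential_dense fE); rewrite (embedding_gt0 F_alpha_morphism).
    exact: alpha_indicator_gt0.
  by case: F_alpha_essential.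
have fa0 : 0 < f a by rewrite (embedding_gt0 fM fi).
have fa_out e' : h e' <> beta_unit R d -> f a e' = 0 :> R.
  move=> he'; apply: le_anti; move: (fa e'); rewrite alpha_indicator_eq0// => ->.
  by move/ltW/C_leP: fa0; exact.
have fae : f a e != 0.
  apply/eqP => fae; move: fa0; rewrite (_ : f a = 0) ?ltxx//.
  apply/continuousEP => e'; have [he'|/fa_out//] := pselect (h e' = beta_unit R d).
  by rewrite (_ : e' = e)//; apply: (can_inj hK); rewrite he.
exists ((f a e)^-1 *: a); rewrite (linearZ_of fL); apply/continuousEP => e'.
rewrite C_scaleE.
have [he'|he'] := pselect (h e' = beta_unit R d); last first.
  by rewrite alpha_indicator_eq0// (fa_out e')// mulr0.
rewrite alpha_indicator_eq1// (_ : e' = e) ?mulVf//.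
by apply: (can_inj hK); rewrite he.
Qed.

(** A function of finite range is its value at infinity times the unit plus a
    finite combination of indicators of points of [D]. *)
Lemma F_alpha_in_image (u : F R (alpha D)) : exists a, f a = emb u.
Proof.
have [fM _ _] := fE; have [fL _ _ f1] := fM.
have [eL _ _ e1] := F_alpha_morphism.
(* The support is exhausted one point at a time, along a list. *)
have vanishing (s : seq D) : forall v : F R (alpha D),
    (forall d, F_val v (Some d) != 0 -> d \in s) -> F_val v None = 0 ->
    exists a, f a = emb v.
  elim: s => [v v0 vN|d s IHs v vs vN].
    exists 0; rewrite (linear0_of fL); apply/continuousEP => e.
    have [[d _ de]|ne] := pselect (range (@beta_unit R D) (h e)); last first.
      by rewrite (F_alpha_outside _ ne) vN.
    rewrite (F_alpha_at _ (esym de)); apply/esym/eqP.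
    by apply: contraT => /v0.
  have [c fc] := alpha_indicator_in_image d.
  pose k : R := F_val v (Some d).
  have [a fa] : exists a, f a = emb (v - k *: alpha_indicator R d).
    have wE (x : alpha D) : F_val (v - k *: alpha_indicator R d) x =
        F_val v x - k * (x == Some d)%:R by [].
    apply: IHs => [d'|]; rewrite wE; last first.
      by rewrite vN mulr0 subr0.
    have [dd'|dd'] := eqVneq (Some d' : alpha D) (Some d).
      by case: dd' => ->; rewrite mulr1n mulr1 subrr eqxx.
    rewrite mulr0n mulr0 subr0 => /vs; rewrite inE => /orP[/eqP dd|//].
    by rewrite dd eqxx in dd'.
  exists (a + k *: c); rewrite (linearD_of fL) (linearZ_of fL) fa fc.
  by rewrite -(linearZ_of eL) -(linearD_of eL) subrK.
pose k : R := F_val u None.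
have /finite_seqP[s sE] := F_finite_support u.
have [d||a fa] := vanishing s (u - k *: strong_unit).
- rewrite (_ : F_val _ _ = F_val u (Some d) - k * 1)// mulr1 subr_eq0 => ud.
  by have : [set` s] d by rewrite -sE.
- by rewrite (_ : F_val _ _ = k - k * 1)// mulr1 subrr.
exists (a + k *: strong_unit); rewrite (linearD_of fL) (linearZ_of fL) fa f1.
by rewrite -e1 -(linearZ_of eL) -(linearD_of eL) subrK.
Qed.

End FAlphaEmbedding.

(** Choosing preimages gives a map into any other object; it inherits the
    structure because the embedding of that object is injective. *)
Theorem F_alpha_minimum (R : realType) (E : compactHausdorffType)
    (D : discreteTopologicalType) (h : continuousType E (beta R D)) :
  infinite_set [set: E] -> extremally_disconnected E -> homeomorphism h ->
  is_minimum (@calV R E) (F_alpha_over h).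
Proof.
move=> Einf Eed hH; split; first exact/calVP/F_alpha_essential.
move=> p /(calVP _ Eed) pE.
have [l lE] := choice (F_alpha_in_image hH Einf pE).
exists l; first exact: factor_embedding pE (F_alpha_essential hH Einf) lE.
by apply/funext => u; rewrite /= lE.
Qed.

(** * Functions identifying two points *)

Section Identification.
Variables (R : realType) (X : compactHausdorffType) (x y : X).

(** Up to isomorphism, the continuous functions on the quotient of [X] that
    identifies [x] and [y]; a subspace of C(X) avoids forming the quotient. *)
Definition glued : {pred C R X} := mem [set f : C R X | f x = f y].

Record glued_functions : Type :=
  GluedFunction { glued_val : C R X; glued_valP : glued_val \in glued }.

HB.instance Definition _ := [isSub for glued_val].
HB.instance Definition _ := [Choice of glued_functions by <:].

Lemma gluedP (f : C R X) : reflect (f x = f y) (f \in glued).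
Proof. by apply: (iffP idP) => [/set_mem//|fxy]; apply/mem_set. Qed.

Fact glued_submod : submod_closed glued.
Proof.
split=> [|a f g /gluedP fxy /gluedP gxy]; apply/gluedP; first by rewrite !C_0E.
by rewrite !C_addE !C_scaleE fxy gxy.
Qed.

HB.instance Definition _ :=
  GRing.isSubmodClosed.Build R (C R X) glued glued_submod.
HB.instance Definition _ := [SubChoice_isSubLmodule of glued_functions by <:].
HB.instance Definition _ :=
  [SubChoice_isSubPOrder of glued_functions by <: with ring_display].

Implicit Types f g h : glued_functions.

Fact glued_max_subproof f g : C_max (glued_val f) (glued_val g) \in glued.
Proof. by apply/gluedP; congr (Num.max _ _); exact/gluedP/glued_valP. Qed.

Fact glued_min_subproof f g : C_min (glued_val f) (glued_val g) \in glued.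
Proof. by apply/gluedP; congr (Num.min _ _); exact/gluedP/glued_valP. Qed.

Definition glued_max f g := GluedFunction (glued_max_subproof f g).
Definition glued_min f g := GluedFunction (glued_min_subproof f g).

Fact glued_max_le f g h : (glued_max f g <= h) = (f <= h) && (g <= h).
Proof. exact: C_max_le. Qed.

Fact glued_min_ge f g h : (h <= glued_min f g) = (h <= f) && (h <= g).
Proof. exact: C_min_ge. Qed.

Fact glued_le_add2l h f g : f <= g -> h + f <= h + g.
Proof. exact: C_le_add2l. Qed.

Fact glued_scale_ge0 (a : R) f : 0 <= a -> 0 <= f -> 0 <= a *: f.
Proof. exact: C_scale_ge0. Qed.

HB.instance Definition _ := isVectorLattice.Build R glued_functions
  glued_max_le glued_min_ge glued_le_add2l glued_scale_ge0.

Fact glued_one_subproof : C_one R X \in glued.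
Proof. by apply/gluedP; rewrite !C_oneE. Qed.

Definition glued_one := GluedFunction glued_one_subproof.

Lemma glued_val_mulrn f n : glued_val (f *+ n) = glued_val f *+ n.
Proof. by elim: n => [|n IHn]; rewrite ?mulr0n// !mulrS -IHn. Qed.

Fact glued_archimedean f g : (forall n, f *+ n <= g) -> f <= 0.
Proof.
move=> fg; apply: (@C_archimedean R X (glued_val f) (glued_val g)) => n.
by rewrite -glued_val_mulrn; exact: fg.
Qed.

Fact glued_one_ge0 : 0 <= glued_one.
Proof. exact: C_one_ge0. Qed.

Fact glued_strong_unitP f : exists n, vjoin f (- f) <= glued_one *+ n.
Proof.
have [n fn] := C_strong_unitP (glued_val f); exists n.
suff : C_max (glued_val f) (- glued_val f) <= glued_val (glued_one *+ n) by [].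
by rewrite glued_val_mulrn.
Qed.

HB.instance Definition _ := isWStar.Build R glued_functions
  glued_archimedean glued_one_ge0 glued_strong_unitP.

Lemma glued_morphism : wstar_morphism glued_val.
Proof. by split=> [k u v|u v|u v|]. Qed.

End Identification.

Lemma bump_function (R : realType) (K : compactHausdorffType) (k : K) (B : set K) :
  closed B -> ~ B k ->
  exists g : C R K, [/\ forall z, 0 <= g z, g k = 1 & forall z, B z -> g z = 0].
Proof.
move=> cB nBk.
have nK : normal_space K.
  by apply: compact_normal; [exact: compact_hausdorff|exact: compact_setT].
have /(@uniform_separatorP K R)[g [cg g01 g0 g1]] :=
  @normal_completely_regular R K nK (@compact_accessible K) k B cB nBk.
have c1g : continuous (fun z => 1 - g z).
  by move=> z; apply: cvgB; [exact: cvg_cst|exact: cg].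
pose b : C R K := mkcts c1g; exists b; split=> [z||z Bz] /=.
- have := g01 (g z) (imageP _ I); rewrite /= in_itv/= => /andP[_].
  by rewrite subr_ge0.
- have gk : g k = 0 by apply: g0; exists k.
  by change (1 - g k = 1); rewrite gk subr0.
- have gz : g z = 1 by apply: g1; exists z.
  by change (1 - g z = 0); rewrite gz subrr.
Qed.

Definition isolated (K : topologicalType) (x : K) := open [set x].

(** Removing two non-isolated points from a nonempty open set leaves a point
    [q]; the meet of a positive function with a bump at [q] vanishes at [x] and
    [y]. *)
Lemma glued_essential (R : realType) (K : compactHausdorffType) (x y : K) :
  ~ isolated x -> ~ isolated y ->
  essential_embedding (@glued_val R K x y).
Proof.
move=> nx ny; split; [exact: glued_morphism|exact: val_inj|].
move=> b b0; have b_ge0 z : 0 <= b z by move: (ltW b0) => /C_leP; exact.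
have dense_compl (z : K) : ~ isolated z -> dense (~` [set z]).
  move=> nz O [w Ow] oO; apply: contrapT => /set0P/negP/negPn/eqP Oz; apply: nz.
  rewrite /isolated (_ : [set z] = O)//; apply/seteqP; split; last exact/subsets_disjoint.
  move=> _ ->; suff <- : w = z by [].
  by apply: contrapT => wz; have : (O `&` ~` [set z]) w by []; rewrite Oz.
have [e be] := C_gt0_point b0.
have oCx : open (~` [set x]) by exact/closed_openC/closed_point.
have [||q [bq [qx qy]]] :=
  denseI oCx (dense_compl x nx) (dense_compl y ny) (O := [set e | 0 < b e]).
- by exists e.
- exact: C_lt_open.
have [||g [g0 gq gxy]] := @bump_function R K q ([set x] `|` [set y]).
- by apply: closedU; exact: closed_point.
- by case.
have gl : C_min b g \in @glued R K x y.
  apply/gluedP; change (Num.min (b x) (g x) = Num.min (b y) (g y)).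
  have gx : g x = 0 by apply: gxy; left.
  have gy : g y = 0 by apply: gxy; right.
  by rewrite gx gy !min_r.
exists (GluedFunction gl), 1%N; split; last exact: vmeet_lel.
rewrite lt_neqAle; apply/andP; split; last first.
  change ((0 : C R K) <= C_min b g); apply/C_leP => z.
  by change (0 <= Num.min (b z) (g z)); rewrite le_min b_ge0 g0.
apply/eqP => /(congr1 (fun u => glued_val u q)).
change (0 = Num.min (b q) (g q) -> False) => /eqP; apply/negP.
by rewrite lt_eqF// gq lt_min bq ltr01.
Qed.

(** * Isolated points and the minimum *)

(** The bump function [b] vanishes outside the open set and at [y], one of its
    non-isolated points.  A function of the minimum below [b] vanishes at [y],
    so at all non-isolated points, and it vanishes at the isolated points
    because they lie outside the open set. *)
Lemma minimum_isolated_dense (R : realType) (E : compactHausdorffType)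
    (m : object_over (C R E)) :
  extremally_disconnected E -> is_minimum (@calV R E) m ->
  dense [set x : E | isolated x].
Proof.
move=> Eed [/(calVP _ Eed) mE m_min].
have m_const x y a : ~ isolated x -> ~ isolated y -> over_map m a x = over_map m a y.
  move=> nx ny; pose p := ObjectOver (@glued_val R E x y).
  have [l _ ->] : over_le m p.
    by apply: m_min; apply/calVP => //; exact: glued_essential.
  exact/gluedP/glued_valP.
move=> O [x Ox] oO; apply: contrapT => Oiso.
have notiso z : O z -> ~ isolated z by move=> Oz iz; apply: Oiso; exists z.
have [y Oy yx] : exists2 y, O y & y <> x.
  apply: contrapT => Ox1; apply: (notiso x Ox).
  rewrite /isolated (_ : [set x] = O)//; apply/seteqP; split=> [_ ->//|y Oy].
  by apply: contrapT => yx; apply: Ox1; exists y.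
have [||b [b_ge0 bx b0]] := @bump_function R E x (~` O `|` [set y]).
- by apply: closedU; [exact: open_closedC|exact: closed_point].
- by case=> [//|xy]; apply: yx.
have b_gt0 : 0 < b.
  rewrite lt_neqAle; apply/andP; split; last exact/C_leP.
  apply/eqP => b0'; move: bx; rewrite -b0' => /esym/eqP.
  by rewrite C_0E oner_eq0.
have [a a0 /C_leP ab] := essential_dense mE b_gt0.
have [mM mi _] := mE.
have /C_leP ma_ge0 : 0 <= over_map m a by rewrite ltW// (embedding_gt0 mM mi).
have ma_out z : b z = 0 -> over_map m a z = 0.
  by move=> bz; apply: le_anti; rewrite (le_trans (ab z)) ?bz//=; exact: ma_ge0.
move: a0; rewrite -(embedding_gt0 mM mi) (_ : over_map m a = 0) ?ltxx//.
apply/continuousEP => z; have [iz|nz] := pselect (isolated z).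
  by apply: ma_out; apply: b0; left => /notiso.
rewrite (m_const z y)//; last exact: notiso.
by apply: ma_out; apply: b0; right.
Qed.

Lemma compact_bijection_homeomorphic (K L : compactHausdorffType) (g : K -> L) :
  continuous g -> injective g -> (forall y, exists x, g x = y) ->
  homeomorphic L K.
Proof.
move=> cg gi /choice[h hK].
have gK : cancel g h by move=> x; apply: gi; rewrite hK.
exists h, g; split=> //; apply/continuous_closedP => B cB.
rewrite (_ : h @^-1` B = g @` B); last first.
  apply/seteqP; split=> [y /= By|_ [x Bx <-]]; last by rewrite /= gK.
  by exists (h y).
apply: compact_closed; first exact: compact_hausdorff.
apply: continuous_compact; first exact: continuous_subspaceT.
by apply: (@subclosed_compact _ _ setT) => //; exact: compact_setT.
Qed.

(** The open set [B] misses the closure of [A], which is open and so misses the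
    closure of [B]. *)
Lemma disjoint_open_closures (X : topologicalType) (A B : set X) :
  extremally_disconnected X -> open A -> open B -> A `&` B = set0 ->
  closure A `&` closure B = set0.
Proof.
move=> Xed oA oB AB; have clAB : closure A `&` B = set0.
  apply/seteqP; split=> // x [Ax Bx].
  by have := Ax B (open_nbhs_nbhs (conj oB Bx)); rewrite AB => -[].
apply/seteqP; split=> // x [Ax Bx].
have [y [By Ay]] := Bx _ (open_nbhs_nbhs (conj (Xed A oA) Ax)).
by have : (closure A `&` B) y by []; rewrite clAB.
Qed.

Section IsolatedDense.
Variables (R : realType) (E : compactHausdorffType).
Hypothesis Eed : extremally_disconnected E.
Hypothesis iso_dense : dense [set x : E | isolated x].

Definition isolated_points : discreteTopologicalType :=
  discrete_topology [set x : E | isolated x].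

Definition isolated_val (d : isolated_points) : E := set_val d.

Lemma isolated_val_continuous : continuous isolated_val.
Proof.
move=> d U /nbhs_singleton Ud.
by apply: (@filterS _ (nbhs d) _ [set d]); [move=> _ ->|exact: discrete_set1].
Qed.

Lemma isolated_image_open (A : set isolated_points) : open (isolated_val @` A).
Proof.
rewrite (_ : _ @` _ = \bigcup_(d in A) [set isolated_val d]); last first.
  by apply/seteqP; split=> x [d Ad]; [move=> <-; exists d|move=> ->; exists d].
by apply: bigcup_open => d _; exact: (@set_valP _ [set x : E | isolated x] d).
Qed.

(** Two points of the compactification are separated by a coordinate, hence by
    complementary sets of isolated points; the closures of these sets in [E]
    are disjoint and contain the images of the two points. *)
Theorem isolated_dense_homeomorphic : homeomorphic E (beta R isolated_points).
Proof.
have [g cg gi] := @beta_universal R isolated_points E _ isolated_val_continuous.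
have gE d : g (beta_unit R d) = isolated_val d by rewrite -gi.
apply: (@compact_bijection_homeomorphic _ _ g) => //; last first.
  move=> y; apply: contrapT => ny.
  have cr : closed (range g).
    apply: compact_closed; first exact: compact_hausdorff.
    apply: continuous_compact; first exact: continuous_subspaceT.
    exact: compact_setT.
  have [||x [/= nx ix]] := iso_dense (O := ~` range g).
  - by exists y => -[x _ xy]; apply: ny; exists x.
  - exact: closed_openC.
  apply: nx; pose d : isolated_points := exist _ x (mem_set ix).
  by exists (beta_unit R d) => //; rewrite gE.
have sep z (V : set isolated_points) (W : set (beta R isolated_points)) :
    open W -> W z -> (forall d, W (beta_unit R d) -> V d) ->
    closure (isolated_val @` V) (g z).
  move=> oW Wz WV B Bgz.
  have gB : nbhs z (g @^-1` B) := cg z B Bgz.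
  have : nbhs z (g @^-1` B `&` W).
    by apply: filterI => //; exact: open_nbhs_nbhs.
  rewrite nbhsE; case=> N [oN Nz] NB.
  have [w [Nw [d _ dw]]] :=
    @beta_unit_dense R isolated_points N (ex_intro _ z Nz) oN.
  have [Bw Ww] := NB w Nw.
  exists (isolated_val d); split; first by exists d => //; apply: WV; rewrite dw.
  by rewrite -gE dw.
have lt_ne z w (u : unit_functions R isolated_points) :
    beta_coord u z < beta_coord u w -> g z <> g w.
  move=> zw gzw.
  pose c := (beta_coord u z + beta_coord u w) / 2.
  pose A := [set d | beta_coord u (beta_unit R d) < c].
  have oc (T : set R) : open T -> open (beta_coord u @^-1` T).
    by move=> oT; apply: open_comp => // x _; exact: beta_coord_continuous.
  have Az : closure (isolated_val @` A) (g z).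
    apply: (sep z A (beta_coord u @^-1` [set t | t < c])) => //.
      by apply: oc; exact: open_lt.
    by rewrite /c /=; lra.
  have Bw : closure (isolated_val @` (~` A)) (g w).
    apply: (sep w (~` A) (beta_coord u @^-1` [set t | c < t])) => //.
    - by apply: oc; exact: open_gt.
    - by rewrite /c /=; lra.
    - by move=> d /= cd; rewrite /A /= => /(lt_trans cd); rewrite ltxx.
  have AB : isolated_val @` A `&` isolated_val @` (~` A) = set0.
    apply/seteqP; split=> // _ [[d Ad <-] [d' nAd' dd']].
    by apply: nAd'; rewrite (val_inj dd').
  have := disjoint_open_closures Eed (@isolated_image_open A)
    (@isolated_image_open (~` A)) AB.
  move=> /seteqP[/(_ (g z)) + _]; apply; split => //.
  by rewrite gzw.
move=> z w gzw; apply: val_inj; apply/funext => u; apply: contrapT => uzw.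
have [/lt_ne|/lt_ne|] := ltgtP (beta_coord u z) (beta_coord u w).
- by apply.
- by apply; rewrite gzw.
- exact: uzw.
Qed.

End IsolatedDense.

Theorem theorem7p10 (R : realType) (E : compactHausdorffType)
    (E_infinite : infinite_set [set: E])
    (E_ed : extremally_disconnected E) :
  ((exists m : object_over (C R E), is_minimum (@calV R E) m) <->
   (exists D : discreteTopologicalType, homeomorphic E (beta R D))) /\
  (forall (D : discreteTopologicalType) (h : continuousType E (beta R D)),
     homeomorphism h -> is_minimum (@calV R E) (F_alpha_over h)).
Proof.
have min_beta (D : discreteTopologicalType) (h : continuousType E (beta R D)) :
    homeomorphism h -> is_minimum (@calV R E) (F_alpha_over h).
  exact: F_alpha_minimum.
split=> //; split=> [[m m_min]|[D [h hH]]].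
  exists (isolated_points E); apply: isolated_dense_homeomorphic => //.
  exact: minimum_isolated_dense m_min.
have ch : continuous h by case: hH => g [].
pose H : continuousType E (beta R D) := mkcts ch.
by exists (F_alpha_over H); exact: min_beta.
Qed.
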